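(* Let $S=\{x_1,x_2,\ldots,x_t\}$ be a gcd-closed set of distinct positive integers with $t>5$. Let $x_n\in S$ with $n\ge5$ such that $G_S(x_n)=\{x_2,\ldots,x_{n-1}\}$, $\gcd(G_S(x_n))=x_1$ and $D_S(x_n)=\{x_1,x_{n+1},\ldots,x_m\}$ with $m<t$. If $x_i\mid x_n$ for all $n<i\le t$ and $D_S(x_n)$ is a divisor chain, then $(S)\nmid[S]$.
   Context: $S$ is gcd-closed if $\gcd(x,y)\in S$ for all $x,y\in S$. The GCD matrix $(S)$ is the $t\times t$ matrix with $(i,j)$-entry $\gcd(x_i,x_j)$; the LCM matrix $[S]$ has $(i,j)$-entry $\mathrm{lcm}(x_i,x_j)$. For $A,B\in M_t(\mathbb{Z})$, $A\mid B$ means there is $C\in M_t(\mathbb{Z})$ with $B=AC$ or $B=CA$; $A\nmid B$ otherwise. For $x<y$ in $S$, $x$ is a greatest-type divisor of $y$ in $S$ if $x\mid y$ and $x\mid z\mid y$, $z\in S$ imply $z\in\{x,y\}$; $G_S(y)$ is the set of greatest-type divisors of $y$ in $S$. If $G_S(x)=\{y_1,\ldots,y_k\}$, then $D_S(x)=\{\gcd(y_{i_1},\ldots,y_{i_r}): 2\le r\le k,\ 1\le i_1<\cdots<i_r\le k\}$. A divisor chain is a set totally ordered by divisibility. *)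

(* Defs.v *)
From mathcomp Require Import all_boot all_order all_algebra finmap.

Set Implicit Arguments.
Unset Strict Implicit.
Unset Printing Implicit Defensive.

Local Open Scope fset_scope.

(* {x_i, ..., x_j}, both ends included; empty when j < i. *)
Definition segment (x : nat -> nat) (i j : nat) : {fset nat} :=
  [fset x k | k in index_iota i j.+1].

Definition gcd_closed (S : {fset nat}) : Prop :=
  forall a b : nat, a \in S -> b \in S -> gcdn a b \in S.

Definition fgcd (A : {fset nat}) : nat := \big[gcdn/0%N]_(a <- A) a.

Definition greatest_type_divisor (S : {fset nat}) (a b : nat) : bool :=
  [&& a \in S, b \in S, (a < b)%N, a %| b &
      all (fun c : nat => (a %| c) && (c %| b) ==> (c == a) || (c == b)) S].

Definition gtdivs (S : {fset nat}) (b : nat) : {fset nat} :=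
  [fset a in S | greatest_type_divisor S a b].

(* The gcds of at least two distinct greatest-type divisors of [b] in [S]. *)
Definition gtdivs_gcds (S : {fset nat}) (b : nat) : {fset nat} :=
  [fset fgcd A | A : {fset nat} in
     [fset A in fpowerset (gtdivs S b) | (1 < #|` A|)%N]].

Definition divisor_chain (A : {fset nat}) : Prop :=
  forall a b : nat, a \in A -> b \in A -> (a %| b) || (b %| a).

(* Rows and columns are indexed from 0 while the family is indexed from 1. *)
Definition gcd_matrix (t : nat) (x : nat -> nat) : 'M[int]_t :=
  \matrix_(i < t, j < t) Posz (gcdn (x i.+1) (x j.+1)).

Definition lcm_matrix (t : nat) (x : nat -> nat) : 'M[int]_t :=
  \matrix_(i < t, j < t) Posz (lcmn (x i.+1) (x j.+1)).

Definition mxdivides (t : nat) (A B : 'M[int]_t) : Prop :=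
  exists C : 'M[int]_t, B = (A *m C)%R \/ B = (C *m A)%R.

(* Main.v *)
(** Every element of [S] divides [M := x n].  As the gcds of pairs of greatest-type
    divisors of [M] form a chain, some greatest-type divisor [y] is a multiple
    of all of them.  Consider the functional
      [Phi f = f M - f y - \sum_z (f z - f (gcdn z y))],
    [z] ranging over the other greatest-type divisors.  It is the Moebius
    inversion at [M] in [S]: it kills [gcdn a] for all [a] in [S] but [M].
    Hence, if the GCD matrix divided the LCM matrix, [Phi (gcdn M)] would
    divide [Phi (lcmn y)].  But [0 < Phi (lcmn y) < Phi (gcdn M)], the first
    inequality because the numbers [lcmn y z = u_z * y] have pairwise coprime
    [u_z > 1], at least two in number, so that
    [M / y >= \prod_z u_z > 1 + \sum_z (u_z - 1)]. *)
Require Import Defs.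
From mathcomp Require Import all_boot all_order all_algebra finmap.
From mathcomp Require Import zify.

Import Order.Theory GRing.Theory Num.Theory.

Local Open Scope fset_scope.

(** * The Moebius functional at [M] and its effect on gcds *)

(** Inclusion-exclusion below [M]: remove what lies under [y], then for each [z] what lies under [z]
    but not under [y]. In the application nothing is removed twice, as distinct members of [r] have
    their gcd dividing [y]. *)
Definition moebius_sum (M y : nat) (r : seq nat) (f : nat -> int) : int :=
  (f M - f y - \sum_(z <- r) (f z - f (gcdn z y)))%R.

Lemma eq_moebius_sum (M y : nat) (r : seq nat) (f g : nat -> int) :
    f M = g M -> f y = g y -> {in r, f =1 g} ->
    {in r, forall z, f (gcdn z y) = g (gcdn z y)} ->
  moebius_sum M y r f = moebius_sum M y r g.
Proof.
move=> eqM eqy eqr eqgcd; rewrite /moebius_sum eqM eqy; congr (_ - _)%R.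
by apply: eq_big_seq => z zr; rewrite eqr ?eqgcd.
Qed.

Lemma moebius_sum_lincomb (I : finType) (c : I -> int) (f : I -> nat -> int)
    (M y : nat) (r : seq nat) :
  moebius_sum M y r (fun z => \sum_i c i * f i z)%R =
  (\sum_i c i * moebius_sum M y r (f i))%R.
Proof.
rewrite /moebius_sum.
under [RHS]eq_bigr => i _ do rewrite !mulrBr sumrB mulrBr !mulr_sumr.
by rewrite !sumrB; congr (_ - (_ - _))%R; rewrite exchange_big.
Qed.

(** For [z != w], [gcdn a z] divides [gcdn w z], hence [y], so the summand of [z] vanishes. If [w]
    is [y], then [gcdn a M] and [gcdn a y] are both [a]; otherwise the summand of [w] is
    [a - gcdn a y], which cancels the leading difference. *)
Lemma moebius_sum_gcd_eq0 (M y w a : nat) (r : seq nat) :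
    uniq (y :: r) ->
    {in y :: r &, forall b c, b != c -> gcdn b c %| y} ->
    w \in y :: r -> a %| w -> a %| M ->
  moebius_sum M y r (fun z => Posz (gcdn a z)) = 0%R.
Proof.
move=> /= /andP[yr ur] gcd_dvd_y w_in aw aM; rewrite /moebius_sum.
have eq_gcd z : z \in r -> z != w ->
    (Posz (gcdn a z) - Posz (gcdn a (gcdn z y)) = 0)%R.
  move=> zr zw; apply/eqP; rewrite subr_eq0; apply/eqP; congr Posz.
  apply/eqP; rewrite eqn_dvd !dvdn_gcd !dvdn_gcdl !dvdn_gcdr /=.
  rewrite (dvdn_trans (dvdn_gcdr _ _) (dvdn_gcdl _ _)) andbT.
  apply: (dvdn_trans _ (gcd_dvd_y z w _ w_in zw)); last by rewrite inE zr orbT.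
  by rewrite dvdn_gcd dvdn_gcdr (dvdn_trans (dvdn_gcdl _ _)).
have /gcdn_idPl-> := aM.
move: w_in; rewrite inE; case: eqP => [wy _ | _ /= wr].
  rewrite big1_seq => [|z /= zr]; last first.
    by apply: eq_gcd => //; apply: contraNneq yr => zw; rewrite -wy -zw.
  by have /gcdn_idPl := aw; rewrite wy => ->; rewrite subrr subr0.
rewrite (bigD1_seq w) //= big1_seq => [|z /= /andP[zw zr]]; last exact: eq_gcd.
by rewrite gcdnA (gcdn_idPl aw) addr0 subrr.
Qed.

(** * Products of factors above 1 and coprimality of lcm quotients *)

(** Expanding the product of the [1 + (u z - 1)] gives the left side plus cross terms, and two
    factors above 1 already make a positive cross term. *)
Lemma sum_subn1_lt_prod (T : Type) (s : seq T) (u : T -> nat) :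
    all (fun z => 1 < u z) s -> 1 < size s ->
  1 + \sum_(z <- s) (u z - 1) < \prod_(z <- s) u z.
Proof.
case: s => [|a [|b s]] //= /andP[ua /andP[ub us]] _.
elim: s a b ua ub us => [|c s IHs] a b ua ub /=.
  by rewrite !big_cons !big_nil; nia.
move=> /andP[uc us]; rewrite big_cons [ltnRHS]big_cons.
by move: (IHs b c ub uc us); nia.
Qed.

Lemma prod_coprime_dvdn (T : eqType) (s : seq T) (u : T -> nat) (N : nat) :
    uniq s -> {in s &, forall a b, a != b -> coprime (u a) (u b)} ->
    {in s, forall a, u a %| N} ->
  \prod_(a <- s) u a %| N.
Proof.
elim: s => [|a s IHs] /=; first by rewrite big_nil dvd1n.
move=> /andP[aNs us] cop dvdN; rewrite big_cons Gauss_dvd.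
  rewrite dvdN ?mem_head // IHs // => [b c bs cs|b bs].
    by apply: cop; rewrite inE ?bs ?cs orbT.
  by apply: dvdN; rewrite inE bs orbT.
rewrite big_seq; elim/big_rec: _ => [|b p bs]; first exact: coprimen1.
rewrite coprimeMr => ->; rewrite andbT; apply: cop; rewrite ?inE ?eqxx ?bs ?orbT //.
by apply: contraNneq aNs => ->.
Qed.

Lemma lcmn_gcdr (a b c : nat) :
  lcmn a (gcdn b c) = gcdn (lcmn a b) (lcmn a c).
Proof. exact: (@Order.DistrLatticeTheory.joinIr _ natdvd). Qed.

(** By distributivity the two lcms have gcd [lcmn y (gcdn a b)], which is [y] since [gcdn a b]
    divides [y]. *)
Lemma coprime_lcmn_div (y a b : nat) : 0 < y -> gcdn a b %| y ->
  coprime (lcmn y a %/ y) (lcmn y b %/ y).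
Proof.
move=> y_gt0 ab_y; rewrite /coprime -(eqn_pmul2r y_gt0) mul1n muln_gcdl.
by rewrite !divnK ?dvdn_lcml // -lcmn_gcdr; apply/eqP/lcmn_idPl.
Qed.

(** * Bounds for the functional on lcms with [y] *)

Section MoebiusLcm.

Variables (M y : nat) (r : seq nat).
Hypothesis uniq_yr : uniq (y :: r).
Hypothesis gt0 : {in M :: y :: r, forall a, 0 < a}.
Hypothesis dvdM : {in y :: r, forall a, a %| M}.
Hypothesis antichain : {in y :: r &, forall a b, a %| b -> a = b}.
Hypothesis gcd_dvd : {in y :: r &, forall a b, a != b -> gcdn a b %| y}.

Let y_gt0 : 0 < y. Proof. by apply: gt0; rewrite !inE eqxx orbT. Qed.

Let r_neq z : z \in r -> z != y.
Proof. by move=> zr; apply: contraTneq uniq_yr => <-; rewrite /= zr. Qed.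

Let lcm_gt z : z \in r -> 1 < lcmn y z %/ y.
Proof.
move=> zr; rewrite ltn_divRL ?dvdn_lcml // mul1n.
have z_gt0 : 0 < z by apply: gt0; rewrite !inE zr !orbT.
rewrite ltn_neqAle dvdn_leq ?lcmn_gt0 ?y_gt0 ?dvdn_lcml // andbT.
apply: contraNneq (r_neq _ zr) => y_lcm; apply/eqP/antichain.
- by rewrite inE zr orbT.
- exact: mem_head.
- by rewrite y_lcm dvdn_lcmr.
Qed.

Lemma moebius_sum_lcm_gt0 : 1 < size r ->
  (0 < moebius_sum M y r (fun z => Posz (lcmn y z)))%R.
Proof.
move=> r_gt1; pose u z := lcmn y z %/ y.
have uE z : lcmn y z = u z * y by rewrite divnK ?dvdn_lcml.
have yM : y %| M by apply/dvdM/mem_head.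
have dvd_prod : (\prod_(z <- r) u z) * y %| M.
  rewrite -dvdn_divRL //.
  apply: prod_coprime_dvdn => [|a b ar br ab|a ar].
  - by case/andP: uniq_yr.
  - by apply: coprime_lcmn_div => //; apply: gcd_dvd; rewrite ?inE ?ar ?br ?orbT.
  - rewrite dvdn_divRL // -/(u a) -uE dvdn_lcm yM dvdM //.
    by rewrite inE ar orbT.
have lt_prod : 1 + \sum_(z <- r) (u z - 1) < \prod_(z <- r) u z.
  by apply: sum_subn1_lt_prod => //; apply/allP => z; apply: lcm_gt.
have leM : (\prod_(z <- r) u z) * y <= M.
  by apply: dvdn_leq => //; apply: gt0; rewrite mem_head.
have lcmM : lcmn y M = M by apply/lcmn_idPr.
rewrite /moebius_sum lcmM (lcmn_idPl (dvdnn y)).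
(* As [gcdn z y] divides [y], its lcm with [y] is [y], so each summand is [(u z - 1) * y]. *)
have -> : (\sum_(z <- r) (Posz (lcmn y z) - Posz (lcmn y (gcdn z y))) =
           Posz ((\sum_(z <- r) (u z - 1)) * y))%R.
  rewrite -natz big_distrl natr_sum; apply: eq_big_seq => z zr /=.
  rewrite (lcmn_idPl (dvdn_gcdr _ _)) natz uE mulnBl mul1n subzn //.
  by rewrite leq_pmull // ltnW ?lcm_gt.
by nia.
Qed.

(** Both sides agree at [M] and [y], so the summands are compared. With [g = gcdn y z],
    [lcmn y z - y] equals [(z - g) * y / g], which exceeds [z - g] because [g < y] and [g < z]. *)
Lemma moebius_sum_lcm_lt : 0 < size r ->
  (moebius_sum M y r (fun z => Posz (lcmn y z)) <
   moebius_sum M y r (fun z => Posz (gcdn M z)))%R.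
Proof.
move=> r_gt0; have yM : y %| M by apply/dvdM/mem_head.
have lcmM : lcmn y M = M by apply/lcmn_idPr.
rewrite /moebius_sum lcmM (lcmn_idPl (dvdnn y)) gcdnn (gcdn_idPr yM) ltrD2l ltrN2.
rewrite big_seq [ltRHS]big_seq; apply: ltr_sum => [|z zr].
  by case: (r) r_gt0 => //= a s _; rewrite mem_head.
have z_in : z \in y :: r by rewrite inE zr orbT.
have z_gt0 : 0 < z by apply: gt0; rewrite inE z_in orbT.
rewrite (gcdn_idPr (dvdM _ z_in)) (lcmn_idPl (dvdn_gcdr _ _)).
rewrite (gcdn_idPr (dvdn_trans (dvdn_gcdl _ _) (dvdM _ z_in))).
have := lcm_gt _ zr; rewrite ltn_divRL ?dvdn_lcml // mul1n.
have := muln_lcm_gcd y z; rewrite (gcdnC z y).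
have : gcdn y z < y.
  rewrite ltn_neqAle dvdn_leq ?dvdn_gcdl // andbT.
  apply: contraNneq (r_neq _ zr) => y_gcd; apply/eqP/esym/antichain => //.
    exact: mem_head.
  by rewrite -y_gcd dvdn_gcdr.
by nia.
Qed.

End MoebiusLcm.

(** * Greatest-type divisors and divisor chains *)

Lemma fgcd_dvdn (A : {fset nat}) (a : nat) : a \in A -> fgcd A %| a.
Proof. by move=> aA; rewrite /fgcd (big_rem a) //= dvdn_gcdl. Qed.

Lemma gcdn_in_gtdivs_gcds (S : {fset nat}) (M a b : nat) :
    a \in gtdivs S M -> b \in gtdivs S M -> a != b ->
  gcdn a b \in gtdivs_gcds S M.
Proof.
move=> aG bG ab; apply/imfsetP; exists [fset a; b] => /=.
  rewrite !inE /= fpowersetE cardfs2 ab andbT.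
  by apply/fsubsetP => c; rewrite in_fset2 => /orP[] /eqP->.
rewrite /fgcd (big_fsetD1 a) ?fset21 //= (_ : [fset a; b] `\ a = [fset b]).
  by rewrite big_seq_fset1.
apply/fsetP => c; rewrite !inE; case: (c =P a) => //= ->.
by rewrite (negPf ab).
Qed.

Lemma divisor_chain_top (A : {fset nat}) :
  divisor_chain A -> A != fset0 ->
  exists2 d, d \in A & {in A, forall a, a %| d}.
Proof.
move=> chainA /fset0Pn[a aA].
have : {subset a :: A <= A} by move=> b; rewrite inE => /orP[/eqP->|].
(* Induction runs over lists contained in [A], so the chain hypothesis on [A] stays available
   unchanged. *)
suff top (s : seq nat) : {subset a :: s <= A} ->
    exists2 d, d \in A & {in a :: s, forall b, b %| d}.
  by move=> /top[d dA dtop]; exists d => // b bA; rewrite dtop // inE bA orbT.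
elim: s => [|b s IHs] sA.
  by exists a => // c; rewrite inE => /eqP->.
have [c|d dA dtop] := IHs.
  by rewrite inE => /orP[/eqP->//|cs]; apply: sA; rewrite !inE cs !orbT.
have bA : b \in A by apply: sA; rewrite !inE eqxx orbT.
case/orP: (chainA _ _ bA dA) => [bd|db].
  exists d => // c; rewrite !inE => /or3P[ca|/eqP->//|cs].
    by apply: dtop; rewrite inE ca.
  by apply: dtop; rewrite inE cs orbT.
exists b => // c; rewrite !inE => /or3P[ca|/eqP->//|cs].
  by apply: dvdn_trans db; apply: dtop; rewrite inE ca.
by apply: dvdn_trans db; apply: dtop; rewrite inE cs orbT.
Qed.

(** Climb from [a]: if it is not of greatest type, some [c] in [S] lies strictly between [a] and [M]
    for divisibility, and [M - c < M - a]. *)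
Lemma gtdivs_above (S : {fset nat}) (M a : nat) :
    0 < M -> M \in S -> a \in S -> a %| M -> a != M ->
  exists2 w, w \in gtdivs S M & a %| w.
Proof.
move=> M_gt0 MS; have [k] := ubnP (M - a); elim: k a => // k IHk a ltk aS aM neq.
have lt_aM : a < M by rewrite ltn_neqAle neq dvdn_leq.
have [gtd|] := boolP (greatest_type_divisor S a M).
  by exists a; rewrite // !inE aS gtd.
rewrite /greatest_type_divisor aS MS lt_aM aM /= => /allPn[c cS].
rewrite negb_imply negb_or => /andP[/andP[ac cM] /andP[ca cM']].
have lt_cM : c < M by rewrite ltn_neqAle cM' dvdn_leq.
have lt_ac : a < c by rewrite ltn_neqAle eq_sym ca dvdn_leq // (dvdn_gt0 M_gt0).
have [|w wG cw] := IHk c _ cS cM cM'; first by lia.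
by exists w => //; apply: dvdn_trans cw.
Qed.

Lemma gtdivs_antichain (S : {fset nat}) (M a b : nat) :
  a \in gtdivs S M -> b \in gtdivs S M -> a %| b -> a = b.
Proof.
rewrite !inE /= => /andP[_ /and5P[_ _ _ _ /allP aM]].
move=> /andP[bS /and5P[_ _ lt_bM bM _]] ab.
have := aM b bS; rewrite ab bM /= => /orP[/eqP//|/eqP bM'].
by rewrite bM' ltnn in lt_bM.
Qed.

Lemma segmentP (x : nat -> nat) (i j a : nat) :
  reflect (exists2 k, i <= k <= j & a = x k) (a \in segment x i j).
Proof.
apply: (iffP (imfsetP _ _ _ _)) => -[k ijk ->]; exists k => //.
  by move: ijk; rewrite /= mem_index_iota ltnS.
by rewrite /= mem_index_iota ltnS.
Qed.

(** Both matrices are symmetric, so a right factor and a left factor yield the same kind of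
    relation: the coefficients come from a column or a row of [C]. *)
Lemma mxdivides_gcd_lcm_row (t : nat) (x : nat -> nat) (k : 'I_t) :
    mxdivides (gcd_matrix t x) (lcm_matrix t x) ->
  exists c : 'I_t -> int, forall j : 'I_t,
    Posz (lcmn (x k.+1) (x j.+1)) =
    (\sum_i c i * Posz (gcdn (x i.+1) (x j.+1)))%R.
Proof.
case=> C [] eqC.
  exists (fun i => C i k) => j; move/matrixP/(_ j k): eqC; rewrite !mxE lcmnC => ->.
  by apply: eq_bigr => i _; rewrite mxE mulrC gcdnC.
exists (fun i => C k i) => j; move/matrixP/(_ k j): eqC; rewrite !mxE => ->.
by apply: eq_bigr => i _; rewrite mxE.
Qed.

Theorem theorem3p2 (t n m : nat) (x : nat -> nat)
  (S := segment x 1 t)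
  (ht : (5 < t)%N)
  (hpos : forall i : nat, (1 <= i <= t)%N -> (0 < x i)%N)
  (hinj : forall i j : nat,
     (1 <= i <= t)%N -> (1 <= j <= t)%N -> x i = x j -> i = j)
  (hS : gcd_closed S)
  (hn : (5 <= n <= t)%N)
  (hm : (n <= m < t)%N)
  (hG : gtdivs S (x n) = segment x 2 n.-1)
  (hgcd : fgcd (gtdivs S (x n)) = x 1%N)
  (hD : gtdivs_gcds S (x n) =
        x 1%N |` segment x n.+1 m)
  (hdvd : forall i : nat, (n < i <= t)%N -> x i %| x n)
  (hchain : divisor_chain (gtdivs_gcds S (x n))) :
  ~ mxdivides (gcd_matrix t x) (lcm_matrix t x).
Proof.
move=> div_mx; set M := x n; set G := gtdivs S M.
have xS i : 1 <= i <= t -> x i \in S by move=> it; apply/segmentP; exists i.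
have GS a : a \in G -> a \in S by rewrite !inE => /andP[].
have G_dvdM a : a \in G -> a %| M by rewrite !inE => /andP[_ /and5P[]].
have xG i : 1 < i < n -> x i \in G.
  by move=> i_n; rewrite /G hG; apply/segmentP; exists i => //; lia.
(* Indices above [n] are covered by [hdvd], those from 2 to [n.-1] are greatest-type divisors, and
   [x 1] is the gcd of the latter. *)
have S_dvdM a : a \in S -> a %| M.
  case/segmentP=> i it ->; have [lt_in|lt_ni|->//] := ltngtP i n.
    have [i_gt1|i_le1] := ltnP 1 i; first by apply/G_dvdM/xG; lia.
    have -> : i = 1 by lia.
    have x2G : x 2 \in G by apply: xG; lia.
    by rewrite -hgcd; apply: dvdn_trans (fgcd_dvdn _ _ x2G) (G_dvdM _ x2G).
  by apply: hdvd; lia.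
have S_gt0 a : a \in S -> 0 < a by case/segmentP => i it ->; apply: hpos.
have MS : M \in S by apply: xS; lia.
have [|d dD d_top] := divisor_chain_top _ hchain.
  by rewrite hD; apply/fset0Pn; exists (x 1); rewrite !inE eqxx.
(* The top [d] of the chain is itself the gcd of some set of greatest-type divisors; any member of
   that set serves as [y]. *)
have [y yG d_y] : exists2 y, y \in G & d %| y.
  case/imfsetP: dD => /= A; rewrite !inE fpowersetE => /andP[AG A_gt1] ->.
  have /fset0Pn[y yA] : A != fset0 by rewrite -cardfs_gt0 ltnW.
  by exists y; [apply: (fsubsetP AG) | apply: fgcd_dvdn].
pose r := enum_fset (G `\ y).
have yrG a : (a \in y :: r) = (a \in G).
  by rewrite inE [a \in r]in_fsetD1; case: eqP => // ->.
have uniq_yr : uniq (y :: r).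
  by rewrite /= fset_uniq andbT [y \in r]in_fsetD1 eqxx.
(* Since [5 <= n], the elements [x 2], [x 3], [x 4] are distinct members of [G], and only [y] is
   left out of [r]. *)
have r_gt1 : 1 < size r.
  rewrite -ltnS; apply: (@uniq_leq_size _ [:: x 2; x 3; x 4] (y :: r)).
    rewrite /= !inE !negb_or !andbT -andbA.
    by apply/and3P; split; apply/eqP => /hinj; lia.
  by move=> a; rewrite yrG !in_cons => /or4P[] // /eqP->; apply: xG; lia.
have gt0 : {in M :: y :: r, forall a, 0 < a}.
  by move=> a; rewrite inE => /orP[/eqP->|]; rewrite ?yrG; [|move/GS]; apply: S_gt0.
have dvdM : {in y :: r, forall a, a %| M} by move=> a; rewrite yrG; apply: G_dvdM.
have antichain : {in y :: r &, forall a b, a %| b -> a = b}.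
  by move=> a b; rewrite !yrG; apply: gtdivs_antichain.
have gcd_dvd : {in y :: r &, forall a b, a != b -> gcdn a b %| y}.
  move=> a b; rewrite !yrG => aG bG ab; apply: dvdn_trans d_y.
  by apply/d_top/gcdn_in_gtdivs_gcds.
have [k kt yE] : exists2 k : 'I_t, true & y = x k.+1.
  have /segmentP[[|k] // kt yE] := GS _ yG.
  by exists (Ordinal (kt : k < t)).
have [c lcmE] := mxdivides_gcd_lcm_row _ _ k div_mx.
have lcm_lin a : a \in S ->
    Posz (lcmn y a) = (\sum_i c i * Posz (gcdn (x i.+1) a))%R.
  case/segmentP=> -[|j] // jt ->; rewrite yE.
  exact: (lcmE (Ordinal (jt : j < t))).
(* [n.-1] is the matrix index of [M], rows being counted from 0. *)
have n1t : n.-1 < t by lia.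
have nE : n.-1.+1 = n by lia.
pose Phi := moebius_sum M y r.
have PhiE : Phi (fun a => Posz (lcmn y a)) =
    (c (Ordinal n1t) * Phi (fun a => Posz (gcdn M a)))%R.
  transitivity (Phi (fun a => \sum_i c i * Posz (gcdn (x i.+1) a))%R).
    have rS : {in r, forall a, a \in S}.
      by move=> a ar; apply: GS; rewrite -yrG inE ar orbT.
    apply: eq_moebius_sum => [||a ar|a ar]; apply: lcm_lin => //.
    - exact: GS.
    - exact: rS.
    - by apply: hS; [apply: rS | apply: GS].
  rewrite [LHS]moebius_sum_lincomb (bigD1 (Ordinal n1t)) //= nE big1 ?addr0 // => i ni.
  have xiS : x i.+1 \in S by apply: xS; rewrite /= ltn_ord.
  (* Every term of index other than that of [M] is killed, because [x i.+1] divides some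
     greatest-type divisor [w]. *)
  have [|w wG xw] := gtdivs_above _ _ _ (S_gt0 _ MS) MS xiS (S_dvdM _ xiS).
    apply: contraNneq ni => /hinj iE; apply/eqP/val_inj => /=.
    by have := ltn_ord i; lia.
  by rewrite (moebius_sum_gcd_eq0 _ _ w) ?mulr0 ?yrG ?S_dvdM.
have := moebius_sum_lcm_gt0 _ _ _ uniq_yr gt0 dvdM antichain gcd_dvd r_gt1.
have := moebius_sum_lcm_lt _ _ _ uniq_yr gt0 dvdM antichain (ltnW r_gt1).
rewrite -/Phi PhiE => lt_cA cA_gt0; have := lt_trans cA_gt0 lt_cA.
(* An integer multiple of a positive integer cannot lie strictly between 0 and it: the multiple is
   at most 0 if the coefficient is, and otherwise at least that integer. *)
by move: lt_cA cA_gt0; case: (leP (c (Ordinal n1t)) 0%R); nia.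
Qed.
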